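(* For all integers $d\geq 2$ and $k\geq 2$, we have \[N_{[d]}^{\mathrm{con}}(k)\geq \left(k-1-d\left\lfloor \tfrac{k-2}{d} \right\rfloor\right)d^{\left\lfloor \frac{k-2}{d} \right\rfloor}+\left\lfloor \tfrac{k-2}{d} \right\rfloor+1\geq d^{\frac{k-2}{d}}.\]
   Context: Let $d\geq 2$ be an integer. A $[d]$-tree is a rooted tree in which the children of each vertex are linearly ordered from left to right and the number of children of each vertex is an element of $\{0,1,\dots,d\}$. Isomorphism of $[d]$-trees preserves the root and the left-to-right order of children. Every connected induced subgraph $T^*$ of a $[d]$-tree $\mathcal T$ is itself a $[d]$-tree (rooted at its vertex closest to the root of $\mathcal T$, with the inherited order of children). If $T^*$ is isomorphic as a $[d]$-tree to a $[d]$-tree $T$, then $\mathcal T$ is said to contiguously contain $T$. $N_{[d]}^{\mathrm{con}}(k)$ denotes the minimum number of vertices in a $[d]$-tree that contiguously contains every $[d]$-tree with $k$ vertices. *)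

(* Defs.v *)
From mathcomp Require Import all_boot.
From mathcomp Require Import boolp.

Set Implicit Arguments.
Unset Strict Implicit.
Unset Printing Implicit Defensive.

(* Finite rooted plane trees: the sequence lists the subtrees hanging from the
   children of the root, from left to right. *)
Inductive ptree := Node of seq ptree.

Fixpoint is_dtree (d : nat) (t : ptree) : bool :=
  let: Node ts := t in (size ts <= d) && all (is_dtree d) ts.

(* A vertex is named by its address, the sequence of child indices read along
   the path from the root; the root is [::], and the size of an address is the
   distance from the root. *)
Notation addr := (seq nat).

Fixpoint vertices (t : ptree) : seq addr :=
  let: Node ts := t in
  [::] :: [seq i :: u | i <- iota 0 (size ts),
                        u <- nth [::] (map vertices ts) i].

Definition num_vertices (t : ptree) : nat := size (vertices t).

Definition parent (u : addr) : addr := take (size u).-1 u.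

Definition child (u v : addr) : bool := (v != [::]) && (parent v == u).

Definition left_of (u v : addr) : bool :=
  [&& u != [::], v != [::], parent u == parent v & last 0 u < last 0 v].

Definition adjacent (u v : addr) : bool := child u v || child v u.

Definition connected (S : {pred addr}) : Prop :=
  {in S &, forall u v,
    exists p : seq addr,
      [/\ path adjacent u p, last u p = v & {subset p <= S}]}.

Definition closest_to_root (S : {pred addr}) (r : addr) : Prop :=
  r \in S /\ {in S, forall u, size r <= size u}.

(* A connected set of addresses is regarded as a plane tree rooted at its
   vertex closest to [::], with the inherited edges and order of siblings;
   f is an isomorphism of plane trees from A to B. *)
Definition is_iso (A B : {pred addr}) (f : addr -> addr) : Prop :=
  [/\ {in A, forall u, f u \in B} /\ {in A &, injective f},
      {in B, forall v, exists2 u, u \in A & f u = v},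
      forall r, closest_to_root A r -> closest_to_root B (f r),
      {in A &, forall u v, child (f u) (f v) = child u v}
    & {in A &, forall u v, left_of (f u) (f v) = left_of u v}].

Definition contiguously_contains (t T : ptree) : Prop :=
  exists S : {pred addr},
    [/\ {subset S <= vertices t}, connected S
      & exists f : addr -> addr, is_iso [in vertices T] S f].

Definition con_universal (d k : nat) (t : ptree) : Prop :=
  is_dtree d t /\
  forall T : ptree, is_dtree d T -> num_vertices T = k ->
    contiguously_contains t T.

Lemma mem_vertices_root t : [::] \in vertices t.
Proof. by case: t. Qed.

Lemma mem_vertices_cons ts i u :
  (i :: u \in vertices (Node ts)) =
  (i < size ts) && (u \in vertices (nth (Node [::]) ts i)).
Proof.
rewrite /= inE /=; apply/allpairsPdep/andP => [[j [v [jts vj [-> ->]]]]|[its ui]].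
  move: jts vj; rewrite mem_iota /= add0n => jts.
  by rewrite (nth_map (Node [::])).
by exists i, u; rewrite mem_iota /= add0n its (nth_map (Node [::])).
Qed.

Lemma uniq_vertices t : uniq (vertices t).
Proof.
have [m] : exists m, forall u, u \in vertices t -> size u <= m.
  exists (\max_(u <- vertices t) size u) => u ut.
  by rewrite (big_rem u) //= leq_maxl.
elim: m t => [|m IHm] [ts] lem.
  case: ts lem => [//|t ts] /(_ [:: 0]).
  by rewrite mem_vertices_cons /= mem_vertices_root => /(_ isT).
rewrite /=; apply/andP; split.
  by apply/allpairsPdep => -[i [u []]].
apply: allpairs_uniq_dep => [|i|]; first exact: iota_uniq.
  rewrite mem_iota /= add0n => its; rewrite (nth_map (Node [::])) //.
  case E: (nth _ ts i) => [ss]; apply: IHm => u uss.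
  have := lem (i :: u); rewrite mem_vertices_cons its E uss => /(_ isT).
  by rewrite ltnS.
by move=> [i u] [j v] _ _ /= [-> ->].
Qed.

Lemma mem_parent_vertices t u : u \in vertices t -> parent u \in vertices t.
Proof.
elim: u t => [|i [|j u] IHu] [ts] //; rewrite mem_vertices_cons => /andP[its].
by move=> /IHu; rewrite [parent (i :: _)]/= mem_vertices_cons its.
Qed.

Lemma connected_vertices t : connected [in vertices t].
Proof.
have reach_root n : forall u, size u = n -> u \in vertices t ->
    (exists p : seq addr,
      [/\ path adjacent u p, last u p = [::] & {subset p <= vertices t}]) /\
    (exists p : seq addr,
      [/\ path adjacent [::] p, last [::] p = u & {subset p <= vertices t}]).
  elim: n => [|n IHn] u.
    by move=> /size0nil -> _; split; exists [::].
  move=> su ut; have pt := mem_parent_vertices ut.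
  have u0 : u != [::] by case: (u) su.
  have cu : child (parent u) u by rewrite /child u0 eqxx.
  have sp : size (parent u) = n by rewrite size_take su /= leqnn.
  have [[p [pp lp sbp]] [q [pq lq sbq]]] := IHn _ sp pt.
  split.
    exists (parent u :: p); split=> //=.
      by rewrite pp andbT /adjacent cu orbT.
    by move=> x; rewrite inE => /predU1P[->|/sbp].
  exists (rcons q u); split; rewrite ?last_rcons //.
    by rewrite rcons_path pq lq /adjacent cu.
  by move=> x; rewrite mem_rcons inE => /predU1P[->|/sbq].
move=> u v ut vt.
have [[p [pp lp sbp]] _] := reach_root _ u erefl ut.
have [_ [q [pq lq sbq]]] := reach_root _ v erefl vt.
exists (p ++ q); rewrite cat_path last_cat lp pp pq lq; split=> // x.
by rewrite mem_cat => /orP[/sbp|/sbq].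
Qed.

Fixpoint complete_tree (d n : nat) : ptree :=
  if n is n'.+1 then Node (nseq d (complete_tree d n')) else Node [::].

Lemma complete_tree_dtree d n : is_dtree d (complete_tree d n).
Proof. by elim: n => //= n IHn; rewrite size_nseq leqnn all_nseq IHn orbT. Qed.

Lemma vertices_complete_tree d n T : is_dtree d T -> num_vertices T <= n ->
  {subset vertices T <= vertices (complete_tree d n)}.
Proof.
elim: n T => [|n IHn] [ts]; first by [].
move=> /andP[sts dts] len [|i u]; first by rewrite mem_vertices_root.
rewrite [complete_tree _ _]/= !mem_vertices_cons => /andP[its uts].
have itd : i < d by apply: leq_trans sts.
rewrite size_nseq nth_nseq itd /=.
apply: IHn uts; first exact: (all_nthP _ dts).
rewrite -ltnS; apply: leq_trans len; rewrite /num_vertices /= ltnS.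
rewrite -[X in X <= _](size_map (cons i)); apply: uniq_leq_size.
  by rewrite map_inj_uniq ?uniq_vertices // => x y [].
move=> _ /mapP[v vi ->]; apply/allpairsPdep; exists i, v.
by rewrite mem_iota /= add0n its (nth_map (Node [::])).
Qed.

Lemma con_universal_exists (d k : nat) :
  exists n, `[< exists2 t, con_universal d k t & num_vertices t = n >].
Proof.
exists (num_vertices (complete_tree d k)); apply/asboolP.
exists (complete_tree d k) => //; split; first exact: complete_tree_dtree.
move=> T dT kT; exists [in vertices T]; split.
- by apply: vertices_complete_tree; rewrite ?kT.
- exact: connected_vertices.
- by exists id; split=> //; [split | move=> v; exists v].
Qed.

Definition Ncon (d k : nat) : nat := ex_minn (con_universal_exists d k).

(* Main.v *)
Require Import Defs.
From mathcomp Require Import all_boot all_order all_algebra.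
From mathcomp Require Import reals exp.
From mathcomp Require Import ring zify.
Import Order.TTheory GRing.Theory Num.Theory.
Local Open Scope ring_scope.

Set Implicit Arguments.
Unset Strict Implicit.
Unset Printing Implicit Defensive.

(** Write [k - 2 = d * q + s] with [s < d], so that the bound reads
    [s.+1 * d ^ q + q + 1].

    For each word [w] of length [q] over [{0, .., d - 1}] consider the
    caterpillar whose spine follows the child indices in [w], where every inner
    spine vertex has [d] children and the end of the spine has [s + 1]
    children, all off-spine vertices being leaves.  It has
    [d * q + s + 2 = k] vertices, so a universal [d]-tree [t] contains it.  The
    copy is rigid: a vertex of [t] has at most [d] children, so when all [d]
    children of a vertex are mapped, the [i]-th child goes to the [i]-th child
    ([iso_full_children]).  Hence the end of the spine is mapped to an address
    that ends with [w] ([iso_caterpillar]).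

    The [s + 1] children of that end therefore have [w] written just before
    their last letter, so those for different words [w] are different vertices:
    this gives [s.+1 * d ^ q] vertices at depth more than [q].  Any one of
    them has an ancestor at each depth [0, .., q], which gives [q + 1] more.

    The second inequality reduces to [d ^ s <= s.+1 ^ d], of which one takes
    [d]-th roots. *)

(** * Addresses *)

Lemma parent_rcons u i : parent (rcons u i) = u.
Proof. by rewrite /parent size_rcons -cats1 take_size_cat. Qed.

Lemma child_rcons u i : child u (rcons u i).
Proof. by rewrite /child parent_rcons eqxx andbT -size_eq0 size_rcons. Qed.

Lemma childE u v : child u v -> v = rcons u (last 0%N v).
Proof.
case/lastP: v => [|v i] // /andP[_ /eqP].
by rewrite parent_rcons last_rcons => ->.
Qed.

Lemma left_of_rcons u i j : left_of (rcons u i) (rcons u j) = (i < j)%N.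
Proof.
by rewrite /left_of !parent_rcons !last_rcons eqxx -!size_eq0 !size_rcons.
Qed.

Lemma mem_take_vertices t n u : u \in vertices t -> take n u \in vertices t.
Proof.
elim: n t u => [|n IHn] [ts] [|i u] //; rewrite take_cons !mem_vertices_cons.
by case/andP=> -> /IHn.
Qed.

Lemma dtree_index_lt d t u i :
  is_dtree d t -> rcons u i \in vertices t -> (i < d)%N.
Proof.
elim: u t => [|j u IHu] [ts] /andP[sts dts]; rewrite mem_vertices_cons.
  by case/andP=> /leq_trans-> .
by case/andP=> jts /IHu; apply; apply: (all_nthP _ dts).
Qed.

Lemma num_vertices_Node ts :
  num_vertices (Node ts) = (sumn (map num_vertices ts)).+1.
Proof.
rewrite /num_vertices /= size_allpairs_dep; congr (sumn _).+1.
rewrite (map_comp size vertices ts).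
rewrite -[in RHS](mkseq_nth [::] (map vertices ts)) size_map /mkseq.
by rewrite -map_comp.
Qed.

(** * Rigidity of copies *)

Lemma increasing_self_map_id (n : nat) (g : nat -> nat) :
  (forall i, (i < n)%N -> (g i < n)%N) ->
  (forall i j, (i < j < n)%N -> (g i < g j)%N) ->
  forall i, (i < n)%N -> g i = i.
Proof.
move=> ltg incg.
have gap i j : (i + j < n)%N -> (g i + j <= g (i + j))%N.
  elim: j => [|j IHj]; rewrite ?addn0 // addnS => ltn.
  rewrite addnS; apply: leq_ltn_trans (IHj (ltnW ltn)) _.
  by apply: incg; rewrite ltn ltnSn.
move=> i ltin; apply/eqP; rewrite eqn_leq; apply/andP; split.
  (* Above [i] there must be room for the [n - i.+1] later values. *)
  have eqn : n = (i + (n - i.+1)).+1 by rewrite -addSn subnKC.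
  have ltn : (i + (n - i.+1) < n)%N by rewrite [X in (_ < X)%N]eqn.
  have := leq_ltn_trans (gap _ _ ltn) (ltg _ ltn).
  by rewrite [X in (_ < X)%N]eqn ltnS leq_add2r.
by have := gap 0%N i; rewrite add0n => /(_ ltin)/(leq_trans (leq_addl _ _)).
Qed.

(** The [d] images are children of one vertex, which has only the [d] positions
    [0, .., d - 1] for them, and they come in the right order. *)
Lemma iso_full_children d t T (S : {pred addr}) f u :
  is_dtree d t -> {subset S <= vertices t} -> is_iso [in vertices T] S f ->
  (forall i, (i < d)%N -> rcons u i \in vertices T) ->
  forall i, (i < d)%N -> f (rcons u i) = rcons (f u) i.
Proof.
move=> dt St [[fS _] _ _ fchild fleft] full i ltid.
have uT : u \in vertices T.
  by rewrite -(parent_rcons u i) mem_parent_vertices ?full.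
have fE j : (j < d)%N -> f (rcons u j) = rcons (f u) (last 0%N (f (rcons u j))).
  by move=> ltjd; apply: childE; rewrite fchild ?child_rcons //; apply: full.
rewrite fE //; congr rcons.
apply: (increasing_self_map_id (n := d) (g := fun j => last 0%N (f (rcons u j)))) => //.
  move=> j ltj; apply: (dtree_index_lt (u := f u) dt); rewrite -fE //.
  by apply: St; apply: fS; apply: full.
move=> a b /andP[ltab ltb]; have lta := ltn_trans ltab ltb.
rewrite -(left_of_rcons (f u)) -!fE // fleft ?left_of_rcons //; exact: full.
Qed.

(** * Caterpillars *)

Fixpoint caterpillar (d m : nat) (w : seq nat) : ptree :=
  if w is i :: w' then
    Node (set_nth (Node [::]) (nseq d (Node [::])) i (caterpillar d m w'))
  else Node (nseq m (Node [::])).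

Lemma caterpillar_dtree d m w :
  (m <= d)%N -> all (gtn d) w -> is_dtree d (caterpillar d m w).
Proof.
move=> md; elim: w => [|i w IHw] /=; first by rewrite size_nseq md all_nseq orbT.
case/andP=> ltid /IHw dw; rewrite size_set_nth size_nseq (maxn_idPr ltid) leqnn.
apply/(all_nthP (Node [::])) => j _.
by rewrite nth_set_nth /= nth_nseq !if_same; case: eqP.
Qed.

Lemma num_vertices_caterpillar d m w : all (gtn d) w ->
  num_vertices (caterpillar d m w) = (d * size w + m).+1.
Proof.
have num_leaf : num_vertices (Node [::]) = 1%N by [].
elim: w => [|i w IHw] /=; rewrite num_vertices_Node.
  by rewrite map_nseq sumn_nseq num_leaf mul1n muln0.
case/andP=> ltid /IHw numw.
rewrite set_nthE size_nseq ltid take_nseq 1?ltnW // drop_nseq.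
rewrite map_cat /= !map_nseq sumn_cat /= !sumn_nseq num_leaf numw !mul1n.
by rewrite mulnS; lia.
Qed.

Lemma mem_caterpillar_cons d m i w u : (i < d)%N ->
  (i :: u \in vertices (caterpillar d m (i :: w)))
    = (u \in vertices (caterpillar d m w)).
Proof.
move=> ltid; rewrite [caterpillar _ _ (i :: w)]/= mem_vertices_cons.
by rewrite size_set_nth size_nseq (maxn_idPr ltid) ltid nth_set_nth /= eqxx.
Qed.

Lemma spine_children_caterpillar d m w n i : all (gtn d) w -> (n < size w)%N ->
  (i < d)%N -> rcons (take n w) i \in vertices (caterpillar d m w).
Proof.
elim: w n => [|j w IHw] // [|n] /andP[ltjd dw] ltn ltid.
  rewrite mem_vertices_cons size_set_nth size_nseq (maxn_idPr ltjd) ltid.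
  exact: mem_vertices_root.
by rewrite take_cons rcons_cons mem_caterpillar_cons // IHw.
Qed.

Lemma end_children_caterpillar d m w i : all (gtn d) w -> (i < m)%N ->
  rcons w i \in vertices (caterpillar d m w).
Proof.
elim: w => [|j w IHw] => [_|/andP[ltjd dw]] ltim.
  by rewrite mem_vertices_cons size_nseq ltim mem_vertices_root.
by rewrite rcons_cons mem_caterpillar_cons // IHw.
Qed.

(** Rigidity applies at each spine vertex before the end, so the whole spine
    is translated. *)
Lemma iso_caterpillar d m w t (S : {pred addr}) f :
  is_dtree d t -> {subset S <= vertices t} -> all (gtn d) w ->
  is_iso [in vertices (caterpillar d m w)] S f -> f w = f [::] ++ w.
Proof.
move=> dt St dw isof.
suff H n : (n <= size w)%N -> f (take n w) = f [::] ++ take n w.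
  by have := H _ (leqnn _); rewrite take_size.
elim: n => [|n IHn] ltn; first by rewrite take0 cats0.
rewrite (take_nth 0%N ltn) -rcons_cat -IHn 1?ltnW //.
apply: (iso_full_children dt St isof).
  by move=> i; apply: spine_children_caterpillar.
exact: (allP dw) (mem_nth _ ltn).
Qed.

(** * Counting vertices of a universal tree *)

(** All [m] children of the end of the spine are sent to children of one vertex,
    whose address ends with [w] by [iso_caterpillar]. *)
Lemma children_after_suffix d m w t : is_dtree d t -> all (gtn d) w ->
  contiguously_contains t (caterpillar d m w) ->
  (m <= count (fun v => (v != [::]) && suffix w (parent v)) (vertices t))%N.
Proof.
move=> dt dw [S [St _ [f isof]]].
have fw := iso_caterpillar dt St dw isof.
have [[fS finj] _ _ fchild _] := isof.
have wT i : (i < m)%N -> rcons w i \in vertices (caterpillar d m w).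
  exact: end_children_caterpillar.
rewrite -[X in (X <= _)%N](size_iota 0) -(size_map (fun i => f (rcons w i))).
rewrite -size_filter.
apply: uniq_leq_size.
  rewrite map_inj_in_uniq ?iota_uniq // => i j; rewrite !mem_iota => im jm.
  by move/finj => /(_ (wT _ im) (wT _ jm))/rcons_inj[].
move=> _ /mapP[i + ->]; rewrite mem_iota => im.
have im' := wT i im; have wv : w \in vertices (caterpillar d m w).
  by have := mem_parent_vertices im'; rewrite parent_rcons.
rewrite mem_filter St ?fS // andbT.
have := fchild _ _ wv im'; rewrite child_rcons => /andP[-> /eqP->].
by rewrite fw suffix_suffix.
Qed.

(** A vertex is counted for at most one word, as words of equal length that end
    the same address are equal. *)
Lemma sum_count_suffix_le (q d : nat) (s : seq addr) :
  (\sum_(w : q.-tuple 'I_d)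
     count (fun v => (v != [::]) && suffix (map val w) (parent v)) s
   <= count (fun v => q < size v) s)%N.
Proof.
elim: s => [|v s IHs]; first by rewrite big1.
rewrite big_split /=; apply: leq_add IHs.
rewrite -big_mkcond sum1_card.
case: ltnP => [ltqv|leqv]; last first.
  rewrite eq_card0 // => w; rewrite !inE; apply/andP => -[v0 /size_suffix].
  rewrite size_map size_tuple; case: v v0 leqv => // i v _.
  by rewrite size_take /= ltnSn ltnNge => /negP.
apply/card_le1_eqP => w1 w2.
rewrite ![_ \in _]unfold_in !suffixE !size_map !size_tuple.
move=> /andP[_ /eqP e1] /andP[_ /eqP e2].
by apply/val_inj/(inj_map val_inj); rewrite -e1 -e2.
Qed.

Lemma shallow_vertices t v q : v \in vertices t -> (q < size v)%N ->
  (q.+1 <= count (fun u => size u <= q) (vertices t))%N.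
Proof.
move=> vt ltq; rewrite -[X in (X <= _)%N](size_iota 0).
rewrite -(size_map (take^~ v)) -size_filter.
have sz i : (i <= q)%N -> size (take i v) = i.
  by move=> iq; rewrite size_takel // (leq_trans iq) // ltnW.
apply: uniq_leq_size.
  rewrite map_inj_in_uniq ?iota_uniq // => i j; rewrite !mem_iota !ltnS => iq jq.
  by move/(congr1 size); rewrite !sz.
move=> _ /mapP[i + ->]; rewrite mem_iota ltnS /= => iq.
by rewrite mem_filter sz // iq mem_take_vertices.
Qed.

(** Vertices at depth more than [q] are counted word by word, and those at depth
    at most [q] as ancestors of a single deeper vertex. *)
Lemma Ncon_lower_bound d q s : (2 <= d)%N -> (s < d)%N ->
  (s.+1 * d ^ q + q.+1 <= Ncon d (d * q + s).+2)%N.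
Proof.
move=> d2 ltsd; rewrite /Ncon; case: ex_minnP => _ /boolp.asboolP[t [dt univ] <-] _.
have many (w : q.-tuple 'I_d) : (s.+1 <=
    count (fun v => (v != [::]) && suffix (map val w) (parent v)) (vertices t))%N.
  have dw : all (gtn d) (map val w) by apply/allP => _ /mapP[i _ ->]; apply: ltn_ord.
  apply: (children_after_suffix dt dw); apply: univ.
    exact: caterpillar_dtree.
  by rewrite num_vertices_caterpillar // size_map size_tuple addnS.
have deep : (s.+1 * d ^ q <= count (fun v => q < size v) (vertices t))%N.
  apply: leq_trans (sum_count_suffix_le q d _).
  rewrite -[d in (d ^ _)%N]card_ord -card_tuple mulnC -sum_nat_const.
  by apply: leq_sum => w _; apply: many.
have [v vt ltqv] : exists2 v, v \in vertices t & (q < size v)%N.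
  apply/hasP; rewrite has_count; apply: leq_trans deep.
  by rewrite muln_gt0 expn_gt0 (ltnW d2).
rewrite /num_vertices -(count_predC (fun v : addr => (q < size v)%N)).
apply: leq_add deep _; apply: leq_trans (shallow_vertices vt ltqv) _.
by apply: eq_leq; apply: eq_count => u; rewrite /= -leqNgt.
Qed.

(** * Comparison with the power *)

Lemma succ_exp_le (n s : nat) : (s <= n)%N -> (n.+1 ^ s <= s.+1 * n ^ s)%N.
Proof.
elim: s => // s IHs ltsn; rewrite expnSr.
apply: leq_trans (leq_mul (IHs (ltnW ltsn)) (leqnn _)) _.
rewrite -mulnA mulnS -expnSr mulnDr [leqRHS]mulSn leq_add2r expnS.
by rewrite leq_mul2r ltsn orbT.
Qed.

(** Induction on [n] from the case [n = s]: passing from [n] to [n + 1]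
    multiplies the right-hand side by [s + 1], and the left-hand side by at
    most that much ([succ_exp_le]). *)
Lemma exp_le_succ_exp (n s : nat) : (s <= n)%N -> (n ^ s <= s.+1 ^ n)%N.
Proof.
move/subnKC <-; elim: (n - s)%N => [|j IHj]; first by case: s => // s; rewrite addn0 leq_exp2r.
rewrite addnS expnS; apply: leq_trans (succ_exp_le (leq_addr j s)) _.
by rewrite leq_mul2l IHj orbT.
Qed.

(** Dividing by [d ^ q] leaves [d ^ (s / d) <= s.+1], the [d]-th root of
    [exp_le_succ_exp]. *)
Lemma powR_quotient_le (R : realType) (d q s : nat) : (0 < d)%N -> (s < d)%N ->
  d%:R `^ ((d * q + s)%:R / d%:R) <= s.+1%:R * d%:R ^+ q :> R.
Proof.
move=> d0 ltsd; have dR : d%:R != 0 :> R by rewrite pnatr_eq0 -lt0n.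
have -> : (d * q + s)%:R / d%:R = q%:R + s%:R / d%:R :> R.
  by rewrite natrD natrM mulrDl mulrAC divff // mul1r.
rewrite powRD ?dR ?implybT // powR_mulrn // mulrC ler_wpM2r ?exprn_ge0 //.
rewrite powRrM powR_mulrn // -natrX.
have -> : s.+1%:R = (s.+1 ^ d)%:R `^ d%:R^-1 :> R.
  by rewrite natrX -powR_mulrn // -powRrM divff // powRr1.
by rewrite ge0_ler_powR ?invr_ge0 ?nnegrE // ler_nat exp_le_succ_exp // ltnW.
Qed.

Theorem theorem3p1 (R : realType) (d k : nat) (hd : (2 <= d)%N) (hk : (2 <= k)%N) :
  let q := ((k - 2) %/ d)%N in
  let B : R := (k%:R - 1 - d%:R * q%:R) * d%:R ^+ q + q%:R + 1 in
  (Ncon d k)%:R >= B /\ B >= d%:R `^ ((k%:R - 2) / d%:R).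
Proof.
move=> q B; have d0 : (0 < d)%N by apply: ltnW.
set s := ((k - 2) %% d)%N; have ltsd : (s < d)%N by rewrite ltn_mod.
have kE : k = (d * q + s).+2 by rewrite [(d * q)%N]mulnC -divn_eq; lia.
have BE : B = s.+1%:R * d%:R ^+ q + q.+1%:R.
  rewrite /B {1}kE -!natr1 natrD natrM; ring.
rewrite BE; split.
  rewrite -natrX -natrM -natrD ler_nat [in leqRHS]kE.
  exact: Ncon_lower_bound.
have -> : k%:R - 2 = (d * q + s)%:R :> R by rewrite [in LHS]kE -!natr1; ring.
apply: le_trans (powR_quotient_le R q d0 ltsd) _.
by rewrite lerDl.
Qed.
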